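(* Let $N\ge 1$, $h>0$, $M>0$, $\nu\ge 0$, $\gamma>0$, $\alpha_{\mathrm x},\alpha_{\mathrm v},\beta_{\mathrm x},\beta_{\mathrm v}\ge 0$. Consider the one-step control problem of minimizing, over $(B_1,\dots,B_N)\in[-M,M]^N$, the functional $\mathcal J^{h,N}$ subject to the explicit one-step particle dynamics (both defined in the context), with $\mathcal P$ either of the two statistical operators defined in the context. Assume the parameters are scaled as $$\alpha_{\mathrm x}\to\frac{\alpha_{\mathrm x}}{h},\qquad \beta_{\mathrm x}\to\frac{\beta_{\mathrm x}}{h},\qquad \gamma\to\gamma h,\qquad \nu\to\frac{\nu}{h},$$ i.e. these replacements are made in $\mathcal J^{h,N}$ and in the dynamics. Then the feedback control associated with $\mathcal J^{h,N}$ (that is, the minimizer over $(B_1,\dots,B_N)\in[-M,M]^N$ of the functional $\mathcal J^{h,N}$ subject to the explicit one-step particle dynamics, with the scaled parameters) is, for every $m=1,\dots,N$, $$B_m=\mathbb P_{[-M,M]}\left(\frac{\mathcal P[\mathcal R^{m,n}_{\mathrm x}(\mathbf z)+\mathcal R^{m,n}_{\mathrm v}(\mathbf z)]}{\gamma+\mathcal P[\mathcal S^{m,n}_{\mathrm x}(\mathbf z)+\mathcal S^{m,n}_{\mathrm v}(\mathbf z)]}\right),$$ where $\mathbb P_{[-M,M]}$ is the projection onto $[-M,M]$ and $$\begin{aligned} \mathcal R^{m,n}_{\mathrm x}(\mathbf z)=&\ \alpha_{\mathrm x}\big(y_m^n(\mathbf z)+h(v_{y_m}^{\star,n}(\mathbf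 z)+hE_{y_m}^n(\mathbf z))-\hat y\big)v_{x_m}^{\star,n}(\mathbf z)\\ &+\beta_{\mathrm x}\big(y_m^n(\mathbf z)+h(v_{y_m}^{\star,n}(\mathbf z)+hE_{y_m}^n(\mathbf z))-\bar y^n(\mathbf z)\big)v_{x_m}^{\star,n}(\mathbf z),\\ \mathcal R^{m,n}_{\mathrm v}(\mathbf z)=&\ \alpha_{\mathrm v}\big(v_{y_m}^{\star,n}(\mathbf z)+hE_{y_m}^n(\mathbf z)\big)v_{x_m}^{\star,n}(\mathbf z) +\beta_{\mathrm v}\big(v_{y_m}^{\star,n}(\mathbf z)+hE_{y_m}^n(\mathbf z)-\bar v_y^{\star,n}(\mathbf z)\big)v_{x_m}^{\star,n}(\mathbf z),\\ \mathcal S^{m,n}_{\mathrm x}(\mathbf z)=&\ (\alpha_{\mathrm x}+\beta_{\mathrm x})\,(h\,v_{x_m}^{\star,n}(\mathbf z))^2,\qquad \mathcal S^{m,n}_{\mathrm v}(\mathbf z)=(\alpha_{\mathrm v}+\beta_{\mathrm v})\,h\,(v_{x_m}^{\star,n}(\mathbf z))^2, \end{aligned}$$ with $$\begin{aligned} v_{x_m}^{\star,n}(\mathbf z)&=\theta_m^{\nu}v_{x_m}^n(\mathbf z)+(1-\theta_m^{\nu})\big(U_{x_m}^n(\mathbf z)+\xi_m\sqrt{T_m^n(\mathbf z)}\big),\\ v_{y_m}^{\star,n}(\mathbf z)&=\theta_m^{\nu}v_{y_m}^n(\mathbf z)+(1-\theta_m^{\nu})\big(U_{y_m}^n(\mathbf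 z)+\xi_m\sqrt{T_m^n(\mathbf z)}\big), \end{aligned}$$ $\theta_m^{\nu}=\chi(\eta_m<e^{-\nu})$, $\bar y^n(\mathbf z)=\frac1N\sum_{j=1}^N y_j^n(\mathbf z)$ and $\bar v_y^{\star,n}(\mathbf z)=\frac1N\sum_{j=1}^N v_{y_j}^{\star,n}(\mathbf z)$. Moreover, in the limit $h\to0$ (with the state at time $t^n=t$, and the random draws, held fixed, and writing $y_m(t,\mathbf z)$, $v_{x_m}(t,\mathbf z)$, etc. for the corresponding values at time $t$), the control becomes $$B_m(t)=\mathbb P_{[-M,M]}\left(\frac1\gamma\,\mathcal P\big[\mathcal R^m_{\mathrm x}(t,\mathbf z)+\mathcal R^m_{\mathrm v}(t,\mathbf z)\big]\right),$$ with $$\begin{aligned} \mathcal R^m_{\mathrm x}(t,\mathbf z)&=\big[\alpha_{\mathrm x}(y_m(t,\mathbf z)-\hat y(t,\mathbf z))+\beta_{\mathrm x}(y_m(t,\mathbf z)-\bar y(t,\mathbf z))\big]v_{x_m}^{\star}(t,\mathbf z),\\ \mathcal R^m_{\mathrm v}(t,\mathbf z)&=\big[\alpha_{\mathrm v}v_{y_m}^{\star}(t,\mathbf z)+\beta_{\mathrm v}(v_{y_m}^{\star}(t,\mathbf z)-\bar v_y^{\star}(t,\mathbf z))\big]v_{x_m}^{\star}(t,\mathbf z), \end{aligned}$$ where $$\begin{aligned} v_{x_m}^{\star}(t,\mathbf z)&=\theta_m^{\nu}v_{x_m}(t,\mathbf z)+(1-\theta_m^{\nu})\big(U_{x_m}(t,\mathbf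 z)+\xi_m\sqrt{T_m(t,\mathbf z)}\big),\\ v_{y_m}^{\star}(t,\mathbf z)&=\theta_m^{\nu}v_{y_m}(t,\mathbf z)+(1-\theta_m^{\nu})\big(U_{y_m}(t,\mathbf z)+\xi_m\sqrt{T_m(t,\mathbf z)}\big), \end{aligned}$$ and $\bar y(t,\mathbf z)$, $\bar v_y^\star(t,\mathbf z)$ are the averages over $m=1,\dots,N$ of $y_m(t,\mathbf z)$ and $v^\star_{y_m}(t,\mathbf z)$.
   Context: **Setting.** $N$ charged particles in the plane, depending on a random parameter $\mathbf z\in\Omega_z\subseteq\mathbb R^{d_z}$ with known probability density $p(\mathbf z)$. At the current time $t^n$, particle $m$ has position $(x_m^n(\mathbf z),y_m^n(\mathbf z))$ and velocity $(v_{x_m}^n(\mathbf z),v_{y_m}^n(\mathbf z))$. The electric field values $(E_{x_m}^n(\mathbf z),E_{y_m}^n(\mathbf z))$, the local mean velocity $(U_{x_m}^n(\mathbf z),U_{y_m}^n(\mathbf z))$ and the local temperature $T_m^n(\mathbf z)\ge0$ at the particle location are given quantities determined by the state at time $t^n$; they do not depend on the control. For each $m$, $\eta_m\sim\mathcal U([0,1])$ and $\xi_m\sim\mathcal N(0,1)$ are given random draws (fixed realizations, used in the collision step), and $\chi(\cdot)$ is the indicator function. The control $B_m\in\mathbb R$ (also written $B_m^{n+1}$) is the value at particle $m$ of the magnetic field component orthogonal to the plane; it does not depend on $\mathbf z$. $M>0$ is the maximum admissible field strength. The target $\hat y$ is given and does not depend on the control. **Explicit one-step dynamics** (time step $h$),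 before scaling: with $\theta_m^{\nu,h}=\chi(\eta_m<e^{-\nu h})$, $$\begin{aligned} x_m^{n+1}(\mathbf z)&=x_m^n(\mathbf z)+h\,v_{x_m}^{n+1}(\mathbf z),\qquad y_m^{n+1}(\mathbf z)=y_m^n(\mathbf z)+h\,v_{y_m}^{n+1}(\mathbf z),\\ v_{x_m}^{n+1}(\mathbf z)&=v_{x_m}^*(\mathbf z)+h\,v_{y_m}^*(\mathbf z)B_m+hE_{x_m}^n(\mathbf z),\\ v_{y_m}^{n+1}(\mathbf z)&=v_{y_m}^*(\mathbf z)-h\,v_{x_m}^*(\mathbf z)B_m+hE_{y_m}^n(\mathbf z),\\ v_{x_m}^*(\mathbf z)&=\theta_m^{\nu,h}v_{x_m}^n(\mathbf z)+(1-\theta_m^{\nu,h})\big(U_{x_m}^n(\mathbf z)+\xi_m\sqrt{T_m^n(\mathbf z)}\big),\\ v_{y_m}^*(\mathbf z)&=\theta_m^{\nu,h}v_{y_m}^n(\mathbf z)+(1-\theta_m^{\nu,h})\big(U_{y_m}^n(\mathbf z)+\xi_m\sqrt{T_m^n(\mathbf z)}\big). \end{aligned}$$ **Cost functional**, before scaling: $$\begin{aligned} \mathcal J^{h,N}=\ &h\,\mathcal P\Big[\sum_{m=1}^N\Big(\tfrac{\alpha_{\mathrm x}}2|y_m^{n+1}(\mathbf z)-\hat y|^2+\tfrac{\beta_{\mathrm x}}2|y_m^{n+1}(\mathbf z)-\bar y^n(\mathbf z)|^2\\ &\quad+\tfrac{\alpha_{\mathrm v}}2|v_{y_m}^{n+1}(\mathbf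 z)|^2+\tfrac{\beta_{\mathrm v}}2|v_{y_m}^{n+1}(\mathbf z)-\bar v_y^*(\mathbf z)|^2\Big)\Big]+\frac{h\gamma}2\,\mathcal P\Big[\sum_{m=1}^N|B_m|^2\Big], \end{aligned}$$ with $\bar y^n(\mathbf z)=\frac1N\sum_m y_m^n(\mathbf z)$ and $\bar v_y^*(\mathbf z)=\frac1N\sum_m v_{y_m}^*(\mathbf z)$. **Statistical operator $\mathcal P$.** It is one of the following: (i) expectation: $\mathcal P[\varphi(\mathbf z)]=\int_{\Omega_z}\varphi(\mathbf z)p(\mathbf z)\,d\mathbf z$; (ii) worst case: $\mathcal P[\varphi(\mathbf z)]=\varphi(\mathbf z_0)$ with $\mathbf z_0=\arg\max_{\mathbf z}T_b(\mathbf z)$, where $T_b(\mathbf z)$ is the temperature near the domain boundary for the value $\mathbf z$ of the uncertainty; the point $\mathbf z_0$ is regarded as given and independent of the control. All quantities are assumed regular enough in $\mathbf z$ for $\mathcal P$ of the expressions involved to be well defined and finite (e.g. in case (i), the positions, starred velocities, electric field values and target are square-integrable with respect to $p(\mathbf z)\,d\mathbf z$). *)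

(* Defs.v *)
From HB Require Import structures.
From mathcomp Require Import all_boot all_order all_algebra.
From mathcomp Require Import all_classical all_reals all_analysis.
From mathcomp Require Import lra.

Set Implicit Arguments.
Unset Strict Implicit.
Unset Printing Implicit Defensive.

Import Order.TTheory GRing.Theory Num.Theory.
Import numFieldNormedType.Exports.

Local Open Scope classical_set_scope.
Local Open Scope ring_scope.

(* R^d with its Borel sigma-algebra. *)
Notation Rspace R d := (d.-tuple (measurableTypeR R)).

Section lebesgue_space.
Variable R : realType.

Definition cons_space n (u : measurableTypeR R * Rspace R n) : Rspace R n.+1 :=
  [tuple of u.1 :: u.2].

Lemma measurable_cons_space n : measurable_fun [set: _] (@cons_space n).
Proof. exact: measurable_cons. Qed.

Definition rect_space n (A : set (measurableTypeR R)) (B : set (Rspace R n)) :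
    set (Rspace R n.+1) :=
  [set t | A (thead t) /\ B [tuple of behead t]].

Lemma preimage_cons_space n (A : set (measurableTypeR R)) (B : set (Rspace R n)) :
  @cons_space n @^-1` rect_space A B = A `*` B.
Proof.
apply/seteqP; rewrite /rect_space; split=> -[a t] /=;
  have -> : [tuple of behead (cons_space (a, t))] = t by exact: val_inj.
  by [].
by [].
Qed.

Lemma measurable_rect_space n (A : set (measurableTypeR R))
    (B : set (Rspace R n)) : measurable A -> measurable B ->
  measurable (rect_space A B).
Proof.
move=> mA mB; apply: measurableI.
- by rewrite -[X in measurable X]setTI; apply: (measurable_tnth ord0).
- by rewrite -[X in measurable X]setTI; apply: measurable_behead.
Qed.

Section step.
Variables (n : nat) (mu : {sigma_finite_measure set (Rspace R n) -> \bar R}).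

Definition lebesgue_step : set (Rspace R n.+1) -> \bar R :=
  pushforward (@lebesgue_measure R \x mu)%E (@cons_space n).


Let mcons (A : set (Rspace R n.+1)) :
  measurable A -> measurable (@cons_space n @^-1` A).
Proof.
by move=> mA; rewrite -[X in measurable X]setTI; apply: measurable_cons_space.
Qed.

Let lebesgue_step0 : lebesgue_step set0 = 0%E.
Proof. by rewrite /lebesgue_step /pushforward preimage_set0 measure0. Qed.

Let lebesgue_step_ge0 A : (0 <= lebesgue_step A)%E.
Proof. by rewrite /lebesgue_step /pushforward; apply: measure_ge0. Qed.

Let lebesgue_step_sigma_additive : semi_sigma_additive lebesgue_step.
Proof.
move=> F mF tF mUF; rewrite /lebesgue_step /pushforward preimage_bigcup.
apply: measure_semi_sigma_additive.
- by move=> k; exact: mcons.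
- apply/trivIsetP => i j _ _ ij; rewrite -preimage_setI.
  by move/trivIsetP : tF => /(_ _ _ Logic.I Logic.I ij) ->; rewrite preimage_set0.
- by rewrite -preimage_bigcup; exact: mcons.
Qed.

HB.instance Definition _ := isMeasure.Build _ _ _ lebesgue_step
  lebesgue_step0 lebesgue_step_ge0 lebesgue_step_sigma_additive.

Lemma lebesgue_step_rect (A : set (measurableTypeR R)) (B : set (Rspace R n)) :
  measurable A -> measurable B ->
  lebesgue_step (rect_space A B) = (lebesgue_measure A * mu B)%E.
Proof.
move=> mA mB.
by rewrite /lebesgue_step /pushforward preimage_cons_space product_measure1E.
Qed.

Let lebesgue_step_sigma_finite : sigma_finite setT lebesgue_step.
Proof.
have /sigma_finiteP[F [TF ndF Foo]] := sigma_finiteT (@lebesgue_measure R).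
have /sigma_finiteP[G [TG ndG Goo]] := sigma_finiteT mu.
exists (fun k => rect_space (F k) (G k)).
  apply/esym; rewrite -subTset => t _ /=.
  have : setT (thead t) by [].
  rewrite TF => -[i _ Fi].
  have : [set: Rspace R n] [tuple of behead t] by [].
  rewrite TG => -[j _ Gj].
  exists (maxn i j) => //; split.
  - by move: Fi; exact/subsetPset/ndF/leq_maxl.
  - by move: Gj; exact/subsetPset/ndG/leq_maxr.
move=> k; have [mFk Fk] := Foo k; have [mGk Gk] := Goo k.
split; first exact: measurable_rect_space.
by rewrite lebesgue_step_rect// lte_mul_pinfty// ge0_fin_numE.
Qed.

HB.instance Definition _ := Measure_isSigmaFinite.Build _ _ _ lebesgue_step
  lebesgue_step_sigma_finite.

End step.

(* Lebesgue measure on the Borel sets of R^d; [lebesgue_space_box] below is its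
   characterization by the volume of boxes. *)
Fixpoint lebesgue_space d : {sigma_finite_measure set (Rspace R d) -> \bar R} :=
  match d with
  | 0 => dirac ([tuple] : Rspace R 0)
  | d'.+1 => lebesgue_step (lebesgue_space d')
  end.

Let box_rect d (A : 'I_d.+1 -> set (measurableTypeR R)) :
  [set t : Rspace R d.+1 | forall i, A i (tnth t i)] =
  rect_space (A ord0) [set t | forall i, A (lift ord0 i) (tnth t i)].
Proof.
have tnth_behead' (t : Rspace R d.+1) i :
    tnth [tuple of behead t] i = tnth t (lift ord0 i).
  by case/tupleP: t => a t; rewrite tnthS; congr tnth; exact: val_inj.
apply/seteqP; split=> [t At|t [A0 At] i].
  by split=> [|i]; [exact: At|rewrite tnth_behead'; exact: At].
have [->|] := eqVneq i ord0; first exact: A0.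
rewrite eq_sym => /unlift_some[j -> _].
by have := At j; rewrite tnth_behead'.
Qed.

Let measurable_box d (A : 'I_d -> set (measurableTypeR R)) :
  (forall i, measurable (A i)) ->
  measurable [set t : Rspace R d | forall i, A i (tnth t i)].
Proof.
elim: d A => [|d IHd] A mA; last first.
  by rewrite box_rect; apply: measurable_rect_space => //;
  have := IHd (A \o lift ord0) (fun i => mA _).
rewrite (_ : [set t | _] = setT); first exact: measurableT.
by apply/seteqP; split=> // t _ [].
Qed.

Lemma lebesgue_space_box d (A : 'I_d -> set (measurableTypeR R)) :
  (forall i, measurable (A i)) ->
  lebesgue_space d [set t | forall i, A i (tnth t i)] =
  (\prod_(i < d) lebesgue_measure (A i))%E.
Proof.
elim: d A => [|d IHd] A mA.
  by rewrite big_ord0 /= /dirac indicE mem_set // => -[].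
rewrite big_ord_recl -IHd // box_rect /= lebesgue_step_rect //.
by have := measurable_box (fun i => mA (lift ord0 i)).
Qed.

End lebesgue_space.

Section one_step_control.
Variables (R : realType) (dz N : nat).
Local Notation Z := (Rspace R dz).

Record parameters := {
  alphax : R; alphav : R; betax : R; betav : R; gamma : R; nu : R }.

Definition scaled (h : R) (par : parameters) := {|
  alphax := alphax par / h;
  alphav := alphav par;
  betax := betax par / h;
  betav := betav par;
  gamma := gamma par * h;
  nu := nu par / h |}.

Record particles := {
  posx : 'I_N -> Z -> R;
  posy : 'I_N -> Z -> R;
  velx : 'I_N -> Z -> R;
  vely : 'I_N -> Z -> R }.

(* Data that do not depend on the control; [eta m] and [xi m] are fixed
   realizations of the uniform and Gaussian draws of particle m. *)
Record environment := {
  Ex : 'I_N -> Z -> R;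
  Ey : 'I_N -> Z -> R;
  Ux : 'I_N -> Z -> R;
  Uy : 'I_N -> Z -> R;
  temp : 'I_N -> Z -> R;
  eta : 'I_N -> R;
  xi : 'I_N -> R;
  yhat : Z -> R }.

Definition mean (f : 'I_N -> Z -> R) (z : Z) : R :=
  N%:R^-1 * \sum_(j < N) f j z.

(* theta^{nu,h} of the time-discrete dynamics, and theta^nu of the rescaled one. *)
Definition theta_step (nu0 h : R) (e : environment) (m : 'I_N) : R :=
  (eta e m < expR (- (nu0 * h)))%R%:R.

Definition theta (nu0 : R) (e : environment) (m : 'I_N) : R :=
  (eta e m < expR (- nu0))%R%:R.

Section collision.
Variables (th : 'I_N -> R) (s : particles) (e : environment).

Definition vxstar (m : 'I_N) (z : Z) : R :=
  th m * velx s m z +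
  (1 - th m) * (Ux e m z + xi e m * Num.sqrt (temp e m z)).

Definition vystar (m : 'I_N) (z : Z) : R :=
  th m * vely s m z +
  (1 - th m) * (Uy e m z + xi e m * Num.sqrt (temp e m z)).

End collision.

Definition next_particles (nu0 h : R) (s : particles) (e : environment)
    (B : 'I_N -> R) : particles :=
  let vxs := vxstar (theta_step nu0 h e) s e in
  let vys := vystar (theta_step nu0 h e) s e in
  let vx m z := vxs m z + h * vys m z * B m + h * Ex e m z in
  let vy m z := vys m z - h * vxs m z * B m + h * Ey e m z in
  {| posx := fun m z => posx s m z + h * vx m z;
     posy := fun m z => posy s m z + h * vy m z;
     velx := vx;
     vely := vy |}.

Inductive stat_operator := Expectation | WorstCase of Z.

Definition stat (Omega : set Z) (p : Z -> R) (o : stat_operator)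
    (phi : Z -> R) : R :=
  match o with
  | Expectation => \int[lebesgue_space R dz]_(z in Omega) (phi z * p z)
  | WorstCase z0 => phi z0
  end.

Definition is_density (Omega : set Z) (p : Z -> R) : Prop :=
  [/\ measurable_fun Omega p,
      forall z, Omega z -> 0 <= p z
    & (\int[lebesgue_space R dz]_(z in Omega) (p z)%:E = 1)%E].

Definition is_argmax (Omega : set Z) (T : Z -> R) (z0 : Z) : Prop :=
  Omega z0 /\ forall z, Omega z -> T z <= T z0.

Definition is_stat_operator (Omega : set Z) (Tb : Z -> R)
    (o : stat_operator) : Prop :=
  match o with
  | Expectation => True
  | WorstCase z0 => is_argmax Omega Tb z0
  end.

Definition square_integrable (Omega : set Z) (p f : Z -> R) : Prop :=
  measurable_fun Omega f /\
  (lebesgue_space R dz).-integrable Omega (fun z => (f z ^+ 2 * p z)%:E).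

(* Under the scaling nu -> nu / h the collision indicator of the dynamics is
   [theta nu], whatever h is, so the starred velocities do not depend on h. *)
Definition regular (Omega : set Z) (p : Z -> R) (nu0 : R) (s : particles)
    (e : environment) (o : stat_operator) : Prop :=
  match o with
  | Expectation =>
    square_integrable Omega p (yhat e) /\
    forall m,
      [/\ square_integrable Omega p (posx s m),
          square_integrable Omega p (posy s m),
          square_integrable Omega p (vxstar (theta nu0 e) s e m)
        & square_integrable Omega p (vystar (theta nu0 e) s e m)] /\
      square_integrable Omega p (Ex e m) /\
      square_integrable Omega p (Ey e m)
  | WorstCase _ => True
  end.

Section control.
Variable P : (Z -> R) -> R.

Definition cost (par : parameters) (h : R) (s : particles) (e : environment)
    (B : 'I_N -> R) : R :=
  let s' := next_particles (nu par) h s e B in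
  let vys := vystar (theta_step (nu par) h e) s e in
  h * P (fun z => \sum_(m < N)
      (alphax par / 2 * `|posy s' m z - yhat e z| ^+ 2
       + betax par / 2 * `|posy s' m z - mean (posy s) z| ^+ 2
       + alphav par / 2 * `|vely s' m z| ^+ 2
       + betav par / 2 * `|vely s' m z - mean vys z| ^+ 2))
  + h * gamma par / 2 * P (fun=> \sum_(m < N) `|B m| ^+ 2).

Definition admissible (M : R) (B : 'I_N -> R) : Prop :=
  forall m, - M <= B m <= M.

Definition feedback_control (par : parameters) (h M : R) (s : particles)
    (e : environment) (B : 'I_N -> R) : Prop :=
  admissible M B /\
  forall B', admissible M B' -> cost par h s e B <= cost par h s e B'.

End control.

Definition proj_itv (M x : R) : R := Num.max (- M) (Num.min M x).

Lemma proj_itv_nearest (M x : R) : 0 <= M ->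
  - M <= proj_itv M x <= M /\
  forall y, - M <= y <= M -> `|x - proj_itv M x| <= `|x - y|.
Proof.
rewrite /proj_itv /Num.max /Num.min => M0.
case: (ltP M x) => xM; case: ltP => MX; split; do ?lra; move=> y /andP[y1 y2];
  rewrite ?subrr ?normr0 ?normr_ge0 //.
- by rewrite !ger0_norm; lra.
- by rewrite !ger0_norm; lra.
- by rewrite !ler0_norm; lra.
Qed.

Section feedback.
Variables (par : parameters) (s : particles) (e : environment).
Let vxs := vxstar (theta (nu par) e) s e.
Let vys := vystar (theta (nu par) e) s e.

Definition Rx (h : R) (m : 'I_N) (z : Z) : R :=
  alphax par * (posy s m z + h * (vys m z + h * Ey e m z) - yhat e z) * vxs m z
  + betax par * (posy s m z + h * (vys m z + h * Ey e m z) - mean (posy s) z)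
    * vxs m z.

Definition Rv (h : R) (m : 'I_N) (z : Z) : R :=
  alphav par * (vys m z + h * Ey e m z) * vxs m z
  + betav par * (vys m z + h * Ey e m z - mean vys z) * vxs m z.

Definition Sx (h : R) (m : 'I_N) (z : Z) : R :=
  (alphax par + betax par) * (h * vxs m z) ^+ 2.

Definition Sv (h : R) (m : 'I_N) (z : Z) : R :=
  (alphav par + betav par) * h * vxs m z ^+ 2.

Definition Rx_lim (m : 'I_N) (z : Z) : R :=
  (alphax par * (posy s m z - yhat e z)
   + betax par * (posy s m z - mean (posy s) z)) * vxs m z.

Definition Rv_lim (m : 'I_N) (z : Z) : R :=
  (alphav par * vys m z + betav par * (vys m z - mean vys z)) * vxs m z.

End feedback.
End one_step_control.

Arguments Expectation {R dz}.

(* Main.v *)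
(* The vertical components at the next step are affine in [B_m], with slope
   [- h^2 vx*] for the position and [- h vx*] for the velocity, so the scaled
   cost is, up to a constant,
     [h^2 sum_m ((gamma + P[S_m]) / 2 * B_m^2 - P[R_m] * B_m)],
   which only requires [P] to be linear on integrable functions, square
   integrability making the products integrable. This sum is strictly convex
   and separable, hence minimized on the box exactly by the projections of the
   [P[R_m] / (gamma + P[S_m])]. Finally [P[R_m]] and [P[S_m]] are polynomials
   in [h], with constant terms [P[R_lim]] and [0]. *)
Require Import Defs.
From mathcomp Require Import all_boot all_order all_algebra.
From mathcomp Require Import all_classical all_reals all_analysis.
From mathcomp Require Import measurable_realfun ring lra.
Set Implicit Arguments.
Unset Strict Implicit.
Unset Printing Implicit Defensive.
Import Order.TTheory GRing.Theory Num.Theory.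
Import numFieldNormedType.Exports.
Local Open Scope classical_set_scope.
Local Open Scope ring_scope.

(** * Projection onto the interval and box-constrained minimization of a separable quadratic *)

Section projection.
Variable R : realType.
Implicit Types M x y : R.

(* The angle at [proj_itv M x] between [x] and any point of the interval is
   obtuse, so [proj_itv M x] is the only minimizer of the distance to [x]. *)
Lemma proj_itv_obtuse M x y : 0 < M -> - M <= y <= M ->
  (proj_itv M x - x) ^+ 2 + (y - proj_itv M x) ^+ 2 <= (y - x) ^+ 2.
Proof.
rewrite /proj_itv /Num.max /Num.min => M0 /andP[y1 y2].
by case: (ltP M x) => xM; case: ltP => Mx; nra.
Qed.

Lemma proj_itv_bounded M x : 0 < M -> - M <= proj_itv M x <= M.
Proof. by move=> /ltW M0; have [] := proj_itv_nearest x M0. Qed.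

Lemma continuous_proj_itv M : continuous (proj_itv M).
Proof.
move=> x; rewrite /proj_itv.
apply: (@continuous_max _ _ (cst (- M)) (cst M \min id)).
  exact: cst_continuous.
by apply: continuous_min; [exact: cst_continuous|exact: cvg_id].
Qed.

(** Each summand is [a i / 2] times the squared distance from [b i] to [r i / a i], up to a
    constant. The obtuse-angle inequality then bounds the excess of [q] over its value at the
    projections from below by a weighted squared distance, which yields minimality and uniqueness at
    once. *)
Lemma separable_quadratic_argmin (I : finType) M (a r b : I -> R) : 0 < M ->
  (forall i, 0 < a i) ->
  let q (b : I -> R) := \sum_i (a i / 2 * b i ^+ 2 - r i * b i) in
  ((forall i, - M <= b i <= M) /\
   (forall b', (forall i, - M <= b' i <= M) -> q b <= q b')) <->
  (forall i, b i = proj_itv M (r i / a i)).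
Proof.
move=> M0 a0 q; pose b0 i := proj_itv M (r i / a i).
have gap b' : (forall i, - M <= b' i <= M) ->
    q b0 + \sum_i a i / 2 * (b' i - b0 i) ^+ 2 <= q b'.
  move=> Mb'; rewrite -big_split; apply: ler_sum => i _ /=.
  have := proj_itv_obtuse (r i / a i) M0 (Mb' i); rewrite -/(b0 i).
  have ai : 0 <= a i / 2 by rewrite divr_ge0// ltW.
  move=> /(ler_wpM2l ai).
  (* Naming the unconstrained minimizer [c] removes the division, so the goal follows linearly from
     the scaled obtuse-angle inequality. *)
  have : r i = a i * (r i / a i) by rewrite mulrC divfK// gt_eqF.
  by move: (r i / a i) (b0 i) (b' i) => c u v ->; nra.
have sq_ge0 (b' : I -> R) i : 0 <= a i / 2 * (b' i - b0 i) ^+ 2.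
  by rewrite mulr_ge0 ?sqr_ge0// divr_ge0// ltW.
split=> [[Mb qb]|bE].
  have Mb0 i : - M <= b0 i <= M by exact: proj_itv_bounded.
  (* Minimality of [b] tested against [b0] leaves no room for a positive gap; a vanishing sum of
     nonnegative terms then vanishes termwise. *)
  have dist0 : \sum_i a i / 2 * (b i - b0 i) ^+ 2 = 0.
    apply/eqP; rewrite eq_le sumr_ge0// andbT.
    by have := gap b Mb; have := qb b0 Mb0; lra.
  move=> i; have /(_ i isT)/eqP := psumr_eq0P (fun i _ => sq_ge0 b i) dist0.
  rewrite mulf_eq0 sqrf_eq0 subr_eq0 => /orP[|/eqP//].
  by rewrite gt_eqF// divr_gt0.
have qbE : q b = q b0 by apply: eq_bigr => i _; rewrite /= bE.
split=> [i|b' Mb']; first by rewrite bE proj_itv_bounded.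
rewrite qbE; apply: le_trans (gap b' Mb').
by rewrite lerDl sumr_ge0.
Qed.

End projection.

(** * Linearity, positivity and integrability for the statistical operator *)

Section statistics.
Variables (R : realType) (dz : nat).
Local Notation Z := (Rspace R dz).
Variables (Omega : set Z) (p : Z -> R) (o : stat_operator R dz).
Hypotheses (hOmega : measurable Omega) (hp : is_density Omega p).
Local Notation P := (stat Omega p o).
Implicit Types (f g : Z -> R) (c : R).

(** The domain on which [P] is linear: evaluation at a point is linear on all functions, so the
    worst case imposes no condition. *)
Definition stat_integrable f : Prop :=
  match o with
  | Expectation =>
      (lebesgue_space R dz).-integrable Omega (fun z => (f z * p z)%:E)
  | WorstCase _ => True
  end.

Definition stat_square_integrable f : Prop :=
  match o with
  | Expectation => square_integrable Omega p f
  | WorstCase _ => True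
  end.

Lemma stat_integrableD f g : stat_integrable f -> stat_integrable g ->
  stat_integrable (fun z => f z + g z).
Proof.
rewrite /stat_integrable; case: o => // fi gi.
apply: (eq_integrable hOmega _ _ _ (integrableD hOmega fi gi)) => z _ /=.
by rewrite -EFinD mulrDl.
Qed.

Lemma stat_integrableZ c f : stat_integrable f ->
  stat_integrable (fun z => c * f z).
Proof.
rewrite /stat_integrable; case: o => // fi.
apply: (eq_integrable hOmega _ _ _ (integrableZl hOmega c fi)) => z _ /=.
by rewrite -EFinM mulrA.
Qed.

Lemma stat_integrable_cst c : stat_integrable (cst c).
Proof.
have -> : cst c = (fun z => c * cst 1 z) :> (Z -> R).
  by apply/funext => z; rewrite /= mulr1.
(* Scaling reduces the claim to the constant 1, that is, to integrability of [p], whose integral is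
   1. *)
apply: stat_integrableZ; rewrite /stat_integrable; case: o => //.
have [mp p0 p1] := hp; apply/integrableP; split.
  by apply/measurable_EFinP; under eq_fun do rewrite mul1r.
under eq_integral => z /[!inE] Oz do rewrite /= mul1r ger0_norm ?p0//.
by rewrite p1 ltry.
Qed.

Lemma stat_integrable_sum (I : Type) (r : seq I) (F : I -> Z -> R) :
  (forall i, stat_integrable (F i)) ->
  stat_integrable (fun z => \sum_(i <- r) F i z).
Proof.
move=> Fi; elim: r => [|i r IHr].
  by under eq_fun do rewrite big_nil; exact: stat_integrable_cst.
by under eq_fun do rewrite big_cons; exact: stat_integrableD.
Qed.

Lemma statD f g : stat_integrable f -> stat_integrable g ->
  P (fun z => f z + g z) = P f + P g.
Proof.
rewrite /stat_integrable /stat; case: o => // fi gi.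
by rewrite -RintegralD//; apply: eq_Rintegral => z _; rewrite mulrDl.
Qed.

Lemma statZ c f : stat_integrable f -> P (fun z => c * f z) = c * P f.
Proof.
rewrite /stat_integrable /stat; case: o => // fi.
by rewrite -RintegralZl//; apply: eq_Rintegral => z _; rewrite mulrA.
Qed.

(** The unit mass of the density gives this normalization, through which the deterministic penalty
    on the control passes out of [P]. *)
Lemma stat_cst c : P (cst c) = c.
Proof.
have -> : cst c = (fun z => c * cst 1 z) :> (Z -> R).
  by apply/funext => z; rewrite /= mulr1.
rewrite statZ; last exact: stat_integrable_cst.
rewrite -[RHS]mulr1; congr (_ * _); rewrite /stat; case: o => //; have [_ _ p1] := hp.
rewrite /Rintegral; under eq_integral => z _ do rewrite mul1r.
by rewrite p1.
Qed.

Lemma stat_sum (I : Type) (r : seq I) (F : I -> Z -> R) :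
  (forall i, stat_integrable (F i)) ->
  P (fun z => \sum_(i <- r) F i z) = \sum_(i <- r) P (F i).
Proof.
move=> Fi; elim: r => [|i r IHr].
  by rewrite big_nil; under eq_fun do rewrite big_nil; exact: stat_cst.
rewrite big_cons -IHr -statD//; last exact: stat_integrable_sum.
by congr P; apply/funext => z; rewrite big_cons.
Qed.

Lemma stat_ge0 f : (forall z, 0 <= f z) -> 0 <= P f.
Proof.
move=> f0; rewrite /stat; case: o => [|z0]; last exact: f0.
have [_ p0 _] := hp.
by apply: Rintegral_ge0 => z Oz; rewrite mulr_ge0 ?p0.
Qed.

Lemma stat_integrableM f g :
  stat_square_integrable f -> stat_square_integrable g ->
  stat_integrable (fun z => f z * g z).
Proof.
rewrite /stat_square_integrable /stat_integrable; case: o => // -[mf f2] [mg g2].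
have [mp p0 _] := hp.
(* Domination by Young's inequality in the crude form [|f g| <= f ^+ 2 + g ^+ 2], weighted by
   [p]. *)
apply: (le_integrable hOmega _ _ (integrableD hOmega f2 g2)).
  apply/measurable_EFinP; apply: measurable_funM => //.
  exact: measurable_funM.
move=> z Oz /=; rewrite lee_fin -mulrDl !normrM (ger0_norm (p0 z Oz)).
rewrite ler_wpM2r ?p0// [leRHS]ger0_norm ?addr_ge0 ?sqr_ge0//.
rewrite -(real_normK (num_real (f z))) -(real_normK (num_real (g z))).
by have := normr_ge0 (f z); have := normr_ge0 (g z); nra.
Qed.

Lemma stat_integrable_sqr f :
  stat_square_integrable f -> stat_integrable (fun z => f z ^+ 2).
Proof. by move=> fi; exact: stat_integrableM. Qed.

Lemma stat_square_integrableD f g :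
  stat_square_integrable f -> stat_square_integrable g ->
  stat_square_integrable (fun z => f z + g z).
Proof.
move=> fi gi; have := stat_integrableM fi gi; move: fi gi.
rewrite /stat_square_integrable /stat_integrable.
case: o => // -[mf f2] [mg g2] fg; split; first exact: measurable_funD.
(* Expansion of the square of [f + g]; the cross term is integrable as a product of
   square-integrable functions. *)
have fg2 := integrableD hOmega (integrableD hOmega f2 g2)
  (integrableZl hOmega 2 fg).
apply: (eq_integrable hOmega _ _ _ fg2) => z _ /=.
by rewrite -EFinM -!EFinD; congr EFin; ring.
Qed.

Lemma stat_square_integrableZ c f : stat_square_integrable f ->
  stat_square_integrable (fun z => c * f z).
Proof.
rewrite /stat_square_integrable; case: o => // -[mf f2]; split.
  by apply: measurable_funM => //; exact: measurable_cst.
apply: (eq_integrable hOmega _ _ _ (integrableZl hOmega (c ^+ 2) f2)) => z _ /=.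
by rewrite -EFinM; congr EFin; ring.
Qed.

Lemma stat_square_integrableB f g :
  stat_square_integrable f -> stat_square_integrable g ->
  stat_square_integrable (fun z => f z - g z).
Proof.
move=> fi gi; under eq_fun do rewrite -[- g _]mulN1r.
by apply: stat_square_integrableD => //; exact: stat_square_integrableZ.
Qed.

Lemma stat_square_integrable_sum (I : Type) (r : seq I) (F : I -> Z -> R) :
  (forall i, stat_square_integrable (F i)) ->
  stat_square_integrable (fun z => \sum_(i <- r) F i z).
Proof.
move=> Fi; elim: r => [|i r IHr].
  under eq_fun do rewrite big_nil; rewrite /stat_square_integrable.
  case: o => //; split; first exact: measurable_cst.
  by under eq_fun do rewrite expr0n mul0r; exact: integrable0.
by under eq_fun do rewrite big_cons; exact: stat_square_integrableD.
Qed.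

Lemma stat_square_integrable_mean N (F : 'I_N -> Z -> R) :
  (forall i, stat_square_integrable (F i)) ->
  stat_square_integrable (mean F).
Proof.
by move=> Fi; apply: stat_square_integrableZ; exact: stat_square_integrable_sum.
Qed.

End statistics.

(** * The scaled one-step problem: quadratic form of the cost, its minimizer, and the limit in
    [h] *)

Section feedback_control.
Variables (R : realType) (dz N : nat).
Local Notation Z := (Rspace R dz).
Variables (Omega : set Z) (p : Z -> R) (o : stat_operator R dz).
Variables (par : parameters R) (s : particles R dz N) (e : environment R dz N).
Hypotheses (hOmega : measurable Omega) (hp : is_density Omega p).
Hypotheses (hgamma : 0 < gamma par).
Hypotheses (halphax : 0 <= alphax par) (halphav : 0 <= alphav par).
Hypotheses (hbetax : 0 <= betax par) (hbetav : 0 <= betav par).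
Hypothesis (hreg : regular Omega p (nu par) s e o).
Local Notation P := (stat Omega p o).
Local Notation L1 := (stat_integrable Omega p o).
Local Notation L2 := (stat_square_integrable Omega p o).
Let vxs := vxstar (theta (nu par) e) s e.
Let vys := vystar (theta (nu par) e) s e.
Let Rxv h m z := Rx par s e h m z + Rv par s e h m z.
Let Sxv h m z := Sx par s e h m z + Sv par s e h m z.
Let Rxv_lim m z := Rx_lim par s e m z + Rv_lim par s e m z.

Lemma theta_step_scaled h : 0 < h ->
  theta_step (nu (scaled h par)) h e = theta (nu par) e.
Proof.
by move=> h0; apply/funext => m; rewrite /theta_step /= divfK// gt_eqF.
Qed.

Lemma regular_L2 : L2 (yhat e) /\ forall m,
  [/\ L2 (posy s m), L2 (vxs m), L2 (vys m) & L2 (Ey e m)].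
Proof.
move: hreg; rewrite /stat_square_integrable; case: o => //= -[yi reg].
by split=> // m; have [[? ? ? ?] []] := reg m.
Qed.

Let yhat2 : L2 (yhat e). Proof. by case: regular_L2. Qed.
Let posy2 m : L2 (posy s m). Proof. by have [_ /(_ m) []] := regular_L2. Qed.
Let vxs2 m : L2 (vxs m). Proof. by have [_ /(_ m) []] := regular_L2. Qed.
Let vys2 m : L2 (vys m). Proof. by have [_ /(_ m) []] := regular_L2. Qed.
Let Ey2 m : L2 (Ey e m). Proof. by have [_ /(_ m) []] := regular_L2. Qed.

Local Ltac solve_L2 :=
  repeat first
    [ exact: yhat2 | exact: posy2 | exact: vxs2 | exact: vys2 | exact: Ey2
    | apply: stat_square_integrable_mean => // ?
    | apply: stat_square_integrableB => //
    | apply: stat_square_integrableD => //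
    | apply: stat_square_integrableZ => // ].

(** [R1] and [R2] are the coefficients of [h] and [h ^+ 2] in [Rxv]; neither depends on [h], because
    the starred velocities do not. *)
Let R1 m z := ((alphax par + betax par) * vys m z
  + (alphav par + betav par) * Ey e m z) * vxs m z.
Let R2 m z := ((alphax par + betax par) * Ey e m z) * vxs m z.

Let RxvE h m z : Rxv h m z = Rxv_lim m z + h * R1 m z + h ^+ 2 * R2 m z.
Proof.
rewrite /Rxv /Rxv_lim /R1 /R2 /Rx /Rv /Rx_lim /Rv_lim -/vxs -/vys; ring.
Qed.

Let SxvE h m z : Sxv h m z =
  ((alphax par + betax par) * h ^+ 2 + (alphav par + betav par) * h)
  * vxs m z ^+ 2.
Proof. rewrite /Sxv /Sx /Sv -/vxs; ring. Qed.

Let Rxv_lim1 m : L1 (Rxv_lim m).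
Proof.
have -> : Rxv_lim m = fun z =>
    (alphax par * (posy s m z - yhat e z)
     + betax par * (posy s m z - mean (posy s) z)
     + (alphav par * vys m z + betav par * (vys m z - mean vys z))) * vxs m z.
  by apply/funext => z; rewrite /Rxv_lim /Rx_lim /Rv_lim -/vxs -/vys; ring.
by apply: stat_integrableM => //; solve_L2.
Qed.

Let R11 m : L1 (R1 m).
Proof. by apply: stat_integrableM => //; solve_L2. Qed.

Let R21 m : L1 (R2 m).
Proof. by apply: stat_integrableM => //; solve_L2. Qed.

Let Rxv1 h m : L1 (Rxv h m).
Proof.
rewrite (funext (RxvE h m)).
by do 2?[apply: stat_integrableD => //]; exact: stat_integrableZ.
Qed.

Let Sxv1 h m : L1 (Sxv h m).
Proof.
rewrite (funext (SxvE h m)).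
by apply: stat_integrableZ => //; apply: stat_integrable_sqr => //; solve_L2.
Qed.

Lemma stat_Rxv h m :
  P (Rxv h m) = P (Rxv_lim m) + h * P (R1 m) + h ^+ 2 * P (R2 m).
Proof.
have hR1 : L1 (fun z => h * R1 m z) by exact: stat_integrableZ.
have hR2 : L1 (fun z => h ^+ 2 * R2 m z) by exact: stat_integrableZ.
rewrite (funext (RxvE h m)) statD//; last exact: stat_integrableD.
by rewrite statD// !statZ.
Qed.

Lemma stat_Sxv h m : P (Sxv h m) =
  ((alphax par + betax par) * h ^+ 2 + (alphav par + betav par) * h)
  * P (fun z => vxs m z ^+ 2).
Proof. by rewrite (funext (SxvE h m)) statZ//; exact: stat_integrable_sqr. Qed.

(** Strict convexity in each [B m]: the penalty contributes [gamma], and [Sxv] is a nonnegative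
    multiple of a square. *)
Lemma gamma_stat_Sxv_gt0 h m : 0 < h -> 0 < gamma par + P (Sxv h m).
Proof.
move=> /ltW h0; rewrite stat_Sxv ltr_pwDl// mulr_ge0//.
  by rewrite addr_ge0// mulr_ge0 ?exprn_ge0 ?addr_ge0.
by apply: stat_ge0 => // z; exact: sqr_ge0.
Qed.

(* The [B]-independent part of the integrand of the cost. *)
Let free h m z :=
  alphax par / h / 2 * (posy s m z + h * (vys m z + h * Ey e m z) - yhat e z) ^+ 2
  + betax par / h / 2
    * (posy s m z + h * (vys m z + h * Ey e m z) - mean (posy s) z) ^+ 2
  + alphav par / 2 * (vys m z + h * Ey e m z) ^+ 2
  + betav par / 2 * (vys m z + h * Ey e m z - mean vys z) ^+ 2.

Let free1 h m : L1 (free h m).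
Proof.
do 3?[apply: stat_integrableD => //]; apply: stat_integrableZ => //;
  by apply: stat_integrable_sqr => //; solve_L2.
Qed.

Lemma cost_quadratic h B : 0 < h ->
  cost P (scaled h par) h s e B =
  h * P (fun z => \sum_(m < N) free h m z) + h ^+ 2 *
  \sum_(m < N) ((gamma par + P (Sxv h m)) / 2 * B m ^+ 2 - P (Rxv h m) * B m).
Proof.
move=> h0; have hN0 : h != 0 by rewrite gt_eqF.
have integrandE : (fun z => \sum_(m < N)
      (alphax (scaled h par) / 2
         * `|posy (next_particles (nu (scaled h par)) h s e B) m z - yhat e z| ^+ 2
       + betax (scaled h par) / 2
         * `|posy (next_particles (nu (scaled h par)) h s e B) m z
             - mean (posy s) z| ^+ 2
       + alphav (scaled h par) / 2
         * `|vely (next_particles (nu (scaled h par)) h s e B) m z| ^+ 2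
       + betav (scaled h par) / 2
         * `|vely (next_particles (nu (scaled h par)) h s e B) m z
             - mean (vystar (theta_step (nu (scaled h par)) h e) s e) z| ^+ 2)) =
    (* Expanding the squares, the terms linear in [B m] collect into [Rxv] and the quadratic ones
       into [Sxv]; the division of the position weights by [h] gives position and velocity terms the
       common prefactors [h] and [h / 2]. *)
    (fun z => \sum_(m < N) free h m z + \sum_(m < N)
      (- (h * B m) * Rxv h m z + h / 2 * B m ^+ 2 * Sxv h m z)).
  apply/funext => z; rewrite -big_split; apply: eq_bigr => m _ /=.
  rewrite !real_normK ?num_real// theta_step_scaled// -/vxs -/vys.
  rewrite /free /Rxv /Sxv /Rx /Rv /Sx /Sv -/vxs -/vys.
  by field.
have RS1 m : L1 (fun z => - (h * B m) * Rxv h m z + h / 2 * B m ^+ 2 * Sxv h m z).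
  by apply: stat_integrableD => //; exact: stat_integrableZ.
rewrite /cost integrandE statD//; [|exact: stat_integrable_sum..].
(* The penalty is deterministic; its scaled weight [h * (gamma par * h) / 2] carries the same factor
   [h ^+ 2] as the other control terms. *)
rewrite [X in _ / 2 * X]stat_cst// mulrDr -addrA; congr (_ + _).
rewrite stat_sum// !mulr_sumr -big_split; apply: eq_bigr => m _ /=.
rewrite statD//; [|exact: stat_integrableZ..].
rewrite !statZ// real_normK ?num_real//.
by field.
Qed.

(** By [cost_quadratic], comparing costs amounts to comparing separable quadratics: the control-free
    term cancels and the factor [h ^+ 2] is positive. *)
Lemma feedback_controlE M h B : 0 < M -> 0 < h ->
  feedback_control P (scaled h par) h M s e B <->
  forall m, B m = proj_itv M (P (Rxv h m) / (gamma par + P (Sxv h m))).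
Proof.
move=> M0 h0.
rewrite -(separable_quadratic_argmin (fun m => P (Rxv h m)) B M0
  (fun m => gamma_stat_Sxv_gt0 m h0)).
split=> -[MB minB]; split=> // B' MB'; move: (minB B' MB');
  by rewrite !cost_quadratic// lerD2l ler_pM2l// exprn_gt0.
Qed.

Lemma feedback_control_limit M m :
  proj_itv M (P (Rxv h m) / (gamma par + P (Sxv h m))) @[h --> 0^'+] -->
  proj_itv M ((gamma par)^-1 * P (Rxv_lim m)).
Proof.
(* Continuity of the projection reduces the claim to the quotient, whose denominator tends to
   [gamma par], which is nonzero. *)
apply: (@cvg_comp _ _ _ (fun h => _) (proj_itv M) _ _ _ _
  (@continuous_proj_itv R M _)).
have id0 : (h : R) @[h --> 0^'+] --> (0 : R) by exact: cvg_within.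
have sq0 : (h ^+ 2 : R) @[h --> 0^'+] --> (0 ^+ 2 : R) by exact: cvgM.
rewrite mulrC; apply: cvgM.
  (* The limit is rewritten as the value at [h = 0] of the polynomial given by [stat_Rxv], to match
     it term by term. *)
  have <- : P (Rxv_lim m) + 0 * P (R1 m) + 0 ^+ 2 * P (R2 m) = P (Rxv_lim m).
    by rewrite expr0n !mul0r !addr0.
  under eq_fun do rewrite stat_Rxv.
  by apply: cvgD; [apply: cvgD; [exact: cvg_cst|exact: cvgMr_tmp]|exact: cvgMr_tmp].
apply: cvgV; first by rewrite gt_eqF.
under eq_fun do rewrite stat_Sxv.
set V := P _.
have : gamma par + ((alphax par + betax par) * h ^+ 2
      + (alphav par + betav par) * h) * V @[h --> 0^'+] -->
    gamma par
    + ((alphax par + betax par) * 0 ^+ 2 + (alphav par + betav par) * 0) * V.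
  apply: cvgD; first exact: cvg_cst.
  by apply: cvgMr_tmp; apply: cvgD; exact: cvgMl_tmp.
by rewrite expr0n !mulr0 addr0 mul0r addr0.
Qed.

End feedback_control.

(** * Feedback law and its limit as the time step vanishes *)

Theorem proposition1 (R : realType) (dz N : nat)
    (Omega : set (Rspace R dz)) (p Tb : Rspace R dz -> R)
    (o : stat_operator R dz) (par : parameters R) (M : R)
    (s : particles R dz N) (e : environment R dz N)
    (hN : (1 <= N)%N) (hM : 0 < M) (hnu : 0 <= nu par) (hgamma : 0 < gamma par)
    (halphax : 0 <= alphax par) (halphav : 0 <= alphav par)
    (hbetax : 0 <= betax par) (hbetav : 0 <= betav par)
    (hOmega : measurable Omega) (hp : is_density Omega p)
    (heta : forall m, 0 <= eta e m <= 1)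
    (htemp : forall m z, Omega z -> 0 <= temp e m z)
    (ho : is_stat_operator Omega Tb o)
    (hreg : regular Omega p (nu par) s e o) :
  let P := stat Omega p o in
  (forall (h : R) (B : 'I_N -> R), 0 < h ->
     feedback_control P (scaled h par) h M s e B <->
     forall m, B m =
       proj_itv M (P (fun z => Rx par s e h m z + Rv par s e h m z) /
               (gamma par + P (fun z => Sx par s e h m z + Sv par s e h m z))))
  /\
  (forall B : R -> 'I_N -> R,
     (forall h, 0 < h -> feedback_control P (scaled h par) h M s e (B h)) ->
     forall m, B h m @[h --> 0^'+] -->
       proj_itv M ((gamma par)^-1 *
               P (fun z => Rx_lim par s e m z + Rv_lim par s e m z))).
Proof.
move=> P; split=> [h B h0|B Bmin m].
  exact: feedback_controlE.
have lim := feedback_control_limit hOmega hp hgamma hreg (M := M) (m := m).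
apply: cvg_trans lim.
(* On a right neighbourhood of 0 every [h] is positive, so the chosen minimizer coincides there with
   the closed formula. *)
apply: near_eq_cvg; near=> h.
have h0 : 0 < h by [].
have /feedback_controlE -> // := Bmin h h0.
Unshelve. all: by end_near.
Qed.
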